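(* Let $\chi:\mathbb{R}^+\to\mathbb{R}$ be a kernel, let $f:\mathbb{R}^{+}\rightarrow\mathbb{R}$ be a bounded measurable function, and let $t\in\mathbb{R}^{+}$ be fixed such that the one-sided limits $f(t+0)$ and $f(t-0)$ exist and are finite. Let $h_{t}:\mathbb{R}^{+}\rightarrow\mathbb{R}$ be defined by $h_t(x)=f(x)-f(t-0)$ if $x<t$, $h_t(x)=f(x)-f(t+0)$ if $x>t$, and $h_t(t)=0$. Let $w>0$. If $w\log t\notin\mathbb{Z}$, then \[ \begin{aligned} (I_{w}^{\chi}f)(t)={}&(I_{w}^{\chi}h_{t})(t)+f(t-0)+\left[\chi\left(e^{w\log t-\lfloor w\log t \rfloor}\right)+\psi_{\chi}^{-}(t^{w})\right](f(t+0)-f(t-0))\\ &-\chi\left(e^{w\log t-\lfloor w\log t \rfloor} \right) \left(w\log t- \lfloor w\log t \rfloor\right)(f(t+0)-f(t-0)), \end{aligned} \] and if $w\log t\in\mathbb{Z}$, then \[ (I_{w}^{\chi}f)(t)=(I_{w}^{\chi}h_{t})(t)+f(t-0)+\left(\chi(1)+\psi_{\chi}^{-}(t^{w})\right)[f(t+0)-f(t-0)]. \]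
   Context: $\mathbb{R}^+$ denotes the positive real numbers and $\lfloor\cdot\rfloor$ the integer part (floor). A function $\chi:\mathbb{R}^+\to\mathbb{R}$ is called a kernel if: (i) $\chi\in L^1(\mathbb{R}^+)$ and $\chi$ is bounded on $[1/e,e]$; (ii) $\sum_{k=-\infty}^{+\infty}\chi(e^{-k}u)=1$ for every $u\in\mathbb{R}^+$; (iii) for some $\nu>0$, $\sup_{u\in\mathbb{R}^+}\sum_{k=-\infty}^{+\infty}|\chi(e^{-k}u)|\,|k-\log u|^{\nu}<+\infty$. For $w>0$ and bounded measurable $f:\mathbb{R}^+\to\mathbb{R}$, the Kantorovich exponential sampling series is \[(I_{w}^{\chi}f)(x)= \sum_{k= - \infty}^{+\infty} \chi(e^{-k} x^{w})\, w \int_{k/w}^{(k+1)/w} f(e^{u})\, du,\quad x\in\mathbb{R}^+.\] The one-sided limits are $f(t+0):=\lim_{y\to0^+}f(t+y)$ and $f(t-0):=\lim_{y\to0^+}f(t-y)$. For $u\in\mathbb{R}^+$, $\psi_\chi^-(u):=\sum_{k\in\mathbb{Z},\,k>\log u}\chi(ue^{-k})$. *)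

(* Defs.v *)
From HB Require Import structures.
From mathcomp Require Import all_boot all_order all_algebra.
From mathcomp Require Import all_classical all_reals all_analysis.

Set Implicit Arguments.
Unset Strict Implicit.
Unset Printing Implicit Defensive.

Import Order.TTheory GRing.Theory Num.Theory.
Import numFieldNormedType.Exports.

Local Open Scope classical_set_scope.
Local Open Scope ring_scope.

(* Functions on the positive half-line are total functions R -> R of which only
   the values on ]0, +oo[ are constrained or used. *)

(* The real line with the Lebesgue sigma-algebra (the completion of the Borel
   one), which is the domain of [completed_lebesgue_measure]. Its carrier is
   convertible to R. *)
Definition lebesgueR (R : realType) :=
  caratheodory_type (@wlength R idfun)^*%mu.

Definition lebesgue_measurable_fun (R : realType) (D : set R) (f : R -> R) :=
  measurable_fun (D : set (lebesgueR R)) (f : lebesgueR R -> measurableTypeR R).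

Definition lebesgue_L1 (R : realType) (D : set R) (f : R -> R) :=
  integrable (@completed_lebesgue_measure R) (D : set (lebesgueR R))
    (EFin \o f).

(* Bilateral series: the terms of index k >= 0 and those of index k < 0 are
   summed separately ([Negz n] is the integer - (n + 1)). *)
Definition zsummable (R : realType) (a : int -> R) :=
  cvgn (series (fun n : nat => a (Posz n))) /\
  cvgn (series (fun n : nat => a (Negz n))).

Definition zsum (R : realType) (a : int -> R) : R :=
  limn (series (fun n : nat => a (Posz n))) +
  limn (series (fun n : nat => a (Negz n))).

Definition is_kernel (R : realType) (chi : R -> R) :=
  [/\ lebesgue_L1 `]0, +oo[ chi /\
      [bounded chi u | u in `[(expR 1)^-1, expR 1]],
      forall u : R, 0 < u ->
        zsummable (fun k : int => chi (expR (- k%:~R) * u)) /\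
        zsum (fun k : int => chi (expR (- k%:~R) * u)) = 1
    & exists2 nu : R, 0 < nu &
        (ereal_sup [set \esum_(k in [set: int])
             (`|chi (expR (- k%:~R) * u)| * `|k%:~R - ln u| `^ nu)%:E
           | u in `]0%R, +oo[] < +oo)%E].

Definition kantorovich (R : realType) (chi : R -> R) (w : R) (f : R -> R)
    (x : R) : R :=
  zsum (fun k : int =>
    chi (expR (- k%:~R) * x `^ w) *
    (w * Rintegral (@completed_lebesgue_measure R)
           (`[k%:~R / w, (k + 1)%:~R / w] : set R)
           (fun u : R => f (expR u)))).

Definition right_lim (R : realType) (f : R -> R) (t : R) : R :=
  lim (f (t + y) @[y --> 0^'+]).

Definition left_lim (R : realType) (f : R -> R) (t : R) : R :=
  lim (f (t - y) @[y --> 0^'+]).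

Definition h_ (R : realType) (f : R -> R) (t : R) (x : R) : R :=
  if x < t then f x - left_lim f t
  else if t < x then f x - right_lim f t
  else 0.

(* Indices k <= log u contribute zero terms to the bilateral series. *)
Definition psi_minus (R : realType) (chi : R -> R) (u : R) : R :=
  zsum (fun k : int =>
    if ln u < k%:~R then chi (u * expR (- k%:~R)) else 0).

(* Main.v *)
Require Import Defs.
From mathcomp Require Import all_boot all_order all_algebra.
From mathcomp Require Import all_classical all_reals all_analysis.
From mathcomp Require Import measurable_realfun ring lra.
Import Order.TTheory GRing.Theory Num.Theory.
Import numFieldNormedType.Exports.
Local Open Scope classical_set_scope.
Local Open Scope ring_scope.

(* On the positive half-line [f] is [h_ f t] plus a function with a single jump
   at [t], so the k-th mean of [f] is the k-th mean of [h_ f t] plus the mean of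
   that jump function: the left limit if [k + 1 <= a], the right limit if
   [a <= k], and an interpolation between them if [k] is the floor of
   [a = w * ln t]. Summing against [chi] gives the formula, the two cases of
   which differ only by the term in [a - floor a]. The means of [f] split only
   because [f \o expR] is Lebesgue measurable, which holds because [ln] maps
   null sets to null sets; the bilateral series split because the moment
   condition on [chi] makes them absolutely convergent. *)

(** * Null sets and Lebesgue measurability under the exponential *)

(* [ln] is [expR n]-Lipschitz on [expR (- n), +oo[. *)
Lemma outer_measure_preimage_expR_le (R : realType) (A : set R) (n : R) :
  ((expR (- n))%:E * (@wlength R idfun)^*%mu (expR @^-1` A `&` `[(- n)%R, +oo[)
    <= (@wlength R idfun)^*%mu A)%E.
Proof.
apply: le_ereal_inf_tmp => _ [B [/= mB AB] <-].
(* An arbitrary countable cover [B] of [A] by half-open intervals is pulled back piece by piece, so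
   by subadditivity it suffices to compare [C k] with [B k]. *)
pose C k : set R := expR @^-1` (B k) `&` `[(- n)%R, +oo[.
have AC : expR @^-1` A `&` `[(- n)%R, +oo[ `<=` \bigcup_k C k.
  by move=> x [/AB[k _ Bkx] xn]; exists k.
apply: (@le_trans _ _ ((expR (- n))%:E *
    \sum_(0 <= k <oo) (@wlength R idfun)^*%mu (C k))%E).
  rewrite lee_pmul2l// ?lte_fin ?expR_gt0//.
  apply: le_trans (outer_measure_sigma_subadditive (@wlength R idfun)^*%mu C).
  exact: le_outer_measure.
rewrite -nneseriesZl; last by move=> k _; exact: outer_measure_ge0.
apply: lee_nneseries => [k _ _|k _].
  by rewrite mule_ge0 ?lee_fin ?expR_ge0// outer_measure_ge0.
have /ocitvP[Bk|[[a b] /= ab Bk]] := mB k.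
  rewrite /C Bk preimage_set0 set0I outer_measure0 mule0.
  exact: wlength_ge0.
(* Cutting the left end at [expR (- n)] keeps [ln a'] meaningful and gives [expR (- n) <= a'], which
   absorbs the Lipschitz factor below. *)
set a' := Num.max a (expR (- n)).
have a'0 : 0 < a' by rewrite lt_max expR_gt0 orbT.
have Ca' x : C k x -> a' <= expR x <= b.
  rewrite /C Bk /= !in_itv/= => -[/andP[ax xb]]; rewrite andbT => nx.
  by rewrite xb ge_max ltW//= ler_expR nx.
have [ba'|a'b] := ltP b a'.
  have -> : C k = set0.
    rewrite -subset0 => x /Ca' /andP[ax /(le_trans ax)].
    by rewrite leNgt ba'.
  by rewrite outer_measure0 mule0; exact: wlength_ge0.
have b0 : 0 < b by exact: lt_le_trans a'b.
have CI : C k `<=` `[ln a', ln b]%classic.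
  move=> x /Ca'/andP[ax xb]; rewrite /= in_itv/=.
  by rewrite -[x]expRK !ler_ln ?posrE ?expR_gt0// ax.
apply: (@le_trans _ _ ((expR (- n))%:E * (ln b - ln a')%:E)%E).
  rewrite lee_pmul2l// ?lte_fin ?expR_gt0//.
  apply: (@le_trans _ _ ((@wlength R idfun)^*%mu `[ln a', ln b]%classic)).
    exact: le_outer_measure.
  rewrite -[X in (X <= _)%E]/(@lebesgue_measure R `[ln a', ln b]%classic).
  rewrite lebesgue_measure_itv; case: ifPn => //= _.
  by rewrite lee_fin subr_ge0 ler_ln ?posrE.
rewrite Bk wlength_itv_bnd ?(ltW ab)//= -EFinM lee_fin -ln_div ?posrE//.
have ba0 : 0 < b / a' by rewrite divr_gt0.
(* With [ln z <= z - 1] at [z = b / a'], the chain is [expR (- n) * ln (b / a') <= a' * (b / a' - 1)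
   = b - a' <= b - a]. *)
have H : ln (b / a') <= b / a' - 1.
  have := @le_ln1Dx R (b / a' - 1); rewrite addrCA subrr addr0; apply.
  by rewrite ltrBrDr addrC subrr.
have na' : expR (- n) <= a' by rewrite le_max lexx orbT.
have aa' : a <= a' by rewrite le_max lexx.
apply: (@le_trans _ _ (a' * (b / a' - 1))).
  apply: (le_trans (ler_wpM2l (expR_ge0 _) H)).
  by rewrite ler_wpM2r// subr_ge0 ler_pdivlMr// mul1r.
by rewrite mulrBr mulrCA divff ?gt_eqF// !mulr1 lerD2l lerN2.
Qed.

(** The Lipschitz bound makes the part of the preimage in each half-line from [- n] null, since its
    factor [expR (- n)] is positive; these countably many parts cover the preimage. *)
Lemma null_preimage_expR (R : realType) (A : set R) :
  (@wlength R idfun)^*%mu A = 0%E -> (@wlength R idfun)^*%mu (expR @^-1` A) = 0%E.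
Proof.
move=> A0; apply/eqP; rewrite eq_le outer_measure_ge0 andbT.
pose C (n : nat) : set R := expR @^-1` A `&` `[(- n%:R)%R, +oo[.
have C0 n : (@wlength R idfun)^*%mu (C n) = 0%E.
  apply/eqP; rewrite eq_le outer_measure_ge0 andbT.
  have := outer_measure_preimage_expR_le _ A n%:R; rewrite A0.
  by rewrite pmule_rle0// lte_fin expR_gt0.
apply: (@le_trans _ _ ((@wlength R idfun)^*%mu (\bigcup_n C n))).
  apply: le_outer_measure => x Ax; exists (Num.truncn `|x|).+1 => //.
  split => //; rewrite /= in_itv/= andbT lerNl.
  by rewrite (le_trans (ler_norm _))// normrN ltW// truncnS_gt.
apply: le_trans (outer_measure_sigma_subadditive (@wlength R idfun)^*%mu C) _.
by rewrite eseries0// => n _ _; exact: C0.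
Qed.

(** A Lebesgue measurable set is a Borel set together with a subset of a Borel null set. The first
    has a Borel preimage by continuity, the second a negligible one by [null_preimage_expR]. *)
Lemma measurable_expR_lebesgue (R : realType) :
  measurable_fun [set: lebesgueR R] (expR : lebesgueR R -> lebesgueR R).
Proof.
move=> _ Y mY; rewrite setTI.
have : (completed_algebra_gen (@lebesgue_measure R)) Y.
  by rewrite -g_sigma_completed_algebra_genE completed_caratheodory_measurable.
move=> [X mX [N [B [mB B0 NB]] <-]].
have mexp (Z : set R) : measurable Z ->
    measurable (expR @^-1` Z : set (lebesgueR R)).
  move=> mZ; apply: sub_caratheodory; rewrite -[_ @^-1` _]setTI.
  exact: measurable_realfun.measurable_expR.
have mX' := mexp X mX.
have mN' : measurable (expR @^-1` N : set (lebesgueR R)).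
  apply: negligible_sub_caratheodory; exists (expR @^-1` B); split.
  - exact: mexp.
  - exact: null_preimage_expR.
  - exact: preimage_subset.
rewrite preimage_setU.
exact: measurableU mX' mN'.
Qed.

(** * Bilateral series and absolute summability of the kernel values *)

Lemma zsummableD (R : realType) (a b : int -> R) :
  zsummable a -> zsummable b -> zsummable (fun k => a k + b k).
Proof.
move=> [a1 a2] [b1 b2]; split.
  exact: (is_cvg_seriesD a1 b1).
exact: (is_cvg_seriesD a2 b2).
Qed.

Lemma zsumD (R : realType) (a b : int -> R) :
  zsummable a -> zsummable b -> zsum (fun k => a k + b k) = zsum a + zsum b.
Proof.
move=> [a1 a2] [b1 b2]; rewrite /zsum addrACA.
by congr (_ + _); [exact: (lim_seriesD a1 b1)|exact: (lim_seriesD a2 b2)].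
Qed.

Lemma zsummableZ (R : realType) (c : R) (a : int -> R) :
  zsummable a -> zsummable (fun k => c * a k).
Proof.
move=> [a1 a2]; split.
  by have h := @is_cvg_seriesZ _ _ c a1; exact: h.
by have h := @is_cvg_seriesZ _ _ c a2; exact: h.
Qed.

Lemma zsumZ (R : realType) (c : R) (a : int -> R) :
  zsummable a -> zsum (fun k => c * a k) = c * zsum a.
Proof.
move=> [a1 a2]; rewrite /zsum mulrDr.
by congr (_ + _); [exact: (lim_seriesZ c a1)|exact: (lim_seriesZ c a2)].
Qed.

Lemma zsummable_dominated (R : realType) (M : R) (a b : int -> R) :
  zsummable (fun k => `|a k|) -> (forall k, `|b k| <= M * `|a k|) ->
  zsummable b.
Proof.
move=> sa ab; have [s1 s2] := zsummableZ _ M _ sa.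
have M0 k : 0 <= M * `|a k| by exact: le_trans (ab k).
by split; apply: normed_cvg;
  [move: s1|move: s2]; apply: series_le_cvg => n;
  by [exact: normr_ge0|exact: M0|exact: ab].
Qed.

Lemma cvg_series_delta (R : realType) (n0 : nat) (c : R) :
  series (fun n => if n == n0 then c else 0) @ \oo --> c.
Proof.
apply: cvg_near_cst; exists n0.+1 => // n /= n0n.
rewrite /series /= big_mkord (bigD1 (Ordinal n0n))//= eqxx big1 ?addr0//.
by move=> i; rewrite -val_eqE /= => /negbTE ->.
Qed.

Lemma cvg_series0 (R : realType) : series (fun _ : nat => 0 : R) @ \oo --> (0 : R).
Proof.
by apply: cvg_near_cst; apply: nearW => n; rewrite /series/= big1.
Qed.

(** Handles the interpolation term, which lives at the single index [Num.floor a]. *)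
Lemma zsum_delta (R : realType) (k0 : int) (c : R) :
  zsummable (fun k => if k == k0 then c else 0) /\
  zsum (fun k => if k == k0 then c else 0) = c.
Proof.
case: k0 => n0; rewrite /zsummable /zsum.
  under [X in cvgn (series X) /\ _]eq_fun do rewrite eqz_nat.
  under [X in _ + limn (series X)]eq_fun do rewrite /=.
  have h1 := cvg_series_delta _ n0 c; have h2 := cvg_series0 R.
  split; first by split; apply: cvgP; [exact: h1|exact: h2].
  by rewrite (cvg_lim _ h1)// (cvg_lim _ h2)// addr0.
have h1 := cvg_series_delta _ n0 c; have h2 := cvg_series0 R.
split; first by split; apply: cvgP; [exact: h2|exact: h1].
by rewrite (cvg_lim _ h2)// (cvg_lim _ h1)// add0r.
Qed.

(** Overwriting the first [N] terms of [v] by those of [u] leaves its convergence unchanged and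
    makes the comparison hold everywhere. *)
Lemma series_near_le_cvg (R : realType) (N : nat) (u v : R ^nat) :
  (forall n, 0 <= u n) -> (forall n, 0 <= v n) ->
  (forall n, (N <= n)%N -> u n <= v n) -> cvgn (series v) -> cvgn (series u).
Proof.
move=> u0 v0 uv cv; pose v' n := if (n < N)%N then u n else v n.
apply: (@series_le_cvg _ _ v') => // [n|n|].
- by rewrite /v'; case: ifP.
- by rewrite /v'; case: ltnP => // /uv.
rewrite -(is_cvg_series_restrict N).
rewrite (_ : (fun n => _) = (fun n => \sum_(N <= k < n) v k)).
  by rewrite is_cvg_series_restrict.
apply/funext => n; apply: eq_big_nat => k /andP[Nk _].
by rewrite /v' ltnNge Nk.
Qed.

(** By injectivity of [e] each partial sum is a finite subsum of the unordered sum, so the partial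
    sums are monotone and bounded. This carries the moment condition over to each half of a
    bilateral series. *)
Lemma cvg_series_esum (R : realType) (T : choiceType) (F : T -> R)
    (e : nat -> T) :
  (forall k, 0 <= F k) -> injective e ->
  (\esum_(k in [set: T]) (F k)%:E < +oo)%E -> cvgn (series (F \o e)).
Proof.
move=> F0 inje Foo.
have E0 : (0 <= \esum_(k in [set: T]) (F k)%:E)%E.
  by apply: esum_ge0 => k _; rewrite lee_fin.
apply: nondecreasing_is_cvgn.
  by apply: nondecreasing_series => n _ _; exact: F0.
exists (fine (\esum_(k in [set: T]) (F k)%:E)) => _ [n _ <-].
rewrite -lee_fin fineK ?ge0_fin_numE//.
apply: esum_ge; exists (e @` `I_n).
  by split => //; apply: finite_image; exact: finite_II.
rewrite fsbig_image; last by move=> i j _ _; exact: inje.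
by rewrite /series /= -sumEFin big_mkord -fsbig_ord.
Qed.

(** Once [k] is at distance at least 1 from [ln u], the weight in the moment condition is at least
    1, so the moment series dominates all but finitely many terms. *)
Lemma kernel_abs_summable (R : realType) (chi : R -> R) (u : R) :
  is_kernel chi -> 0 < u ->
  zsummable (fun k : int => `|chi (expR (- k%:~R) * u)|).
Proof.
move=> [_ _ [nu nu0 supoo]] u0.
pose F (k : int) := `|chi (expR (- k%:~R) * u)| * `|k%:~R - ln u| `^ nu.
have F0 k : 0 <= F k by rewrite mulr_ge0// powR_ge0.
have Foo : (\esum_(k in [set: int]) (F k)%:E < +oo)%E.
  apply: le_lt_trans supoo; apply: ereal_sup_ubound.
  by exists u => //=; rewrite in_itv/= u0.
have far (k : int) : 1 <= `|k%:~R - ln u| ->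
    `|chi (expR (- k%:~R) * u)| <= F k.
  move=> k1; rewrite /F ler_peMr//.
  have := ge0_ler_powR (ltW nu0) _ _ k1.
  by rewrite powR1; apply; rewrite nnegrE.
have N1 := ltW (truncnS_gt `|ln u|); have N2 := ler_norm (ln u).
have N3 := ler_norm (- ln u); rewrite normrN in N3.
(* From this index on, [n >= |ln u| + 1], so both [n] and [- (n + 1)] are at distance at least 1
   from [ln u]. *)
split; apply: (@series_near_le_cvg _ (Num.truncn `|ln u|).+2 _ (F \o _)).
- by [].
- by move=> n; exact: F0.
- move=> n; rewrite -(ler_nat R) => Nn; apply: far.
  rewrite ler_normr; apply/orP; left.
  by move: Nn; rewrite -natr1 -pmulrn => Nn; lra.
- by apply: cvg_series_esum => // i j [].
- by [].
- by move=> n; exact: F0.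
- move=> n; rewrite -(ler_nat R) => Nn; apply: far.
  rewrite ler_normr; apply/orP; right.
  by move: Nn; rewrite NegzE mulrNz -pmulrn -!natr1 => Nn; lra.
- by apply: cvg_series_esum => // i j [].
Qed.

(** * Means over the cells from [k / w] to [(k + 1) / w] *)

Lemma measurable_itv_lebesgueR (R : realType) (i : interval R) :
  measurable ([set` i] : set (lebesgueR R)).
Proof. by apply: sub_caratheodory; exact: measurable_itv. Qed.

Lemma integrable_bounded_comp_expR (R : realType) (f : R -> R) (x y : R) :
  [bounded f x | x in `]0, +oo[] -> lebesgue_measurable_fun `]0, +oo[ f ->
  (@completed_lebesgue_measure R).-integrable (`[x, y] : set (lebesgueR R))
    (EFin \o (fun u => f (expR u))).
Proof.
move=> fb fm; apply: measurable_bounded_integrable.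
- exact: measurable_itv_lebesgueR.
(* On intervals the completed measure is convertible to [lebesgue_measure], whose length formula
   then applies. *)
- rewrite [ltLHS](_ : _ = @lebesgue_measure R `[x, y]%classic)//.
  by rewrite lebesgue_measure_itv; case: ifP => //= _; rewrite -EFinB ltry.
- apply: measurable_funTS.
  apply: (@measurable_comp _ _ _ (lebesgueR R) (lebesgueR R)
    (measurableTypeR R) `]0, +oo[%classic f setT expR) => //.
  + exact: measurable_itv_lebesgueR.
  + by move=> _ [u _ <-] /=; rewrite in_itv/= expR_gt0.
  + exact: measurable_expR_lebesgue.
- have [M [Mr fM]] := fb.
  exists M; split => // N MN u _ /=; apply: (fM N MN).
  by rewrite /= in_itv/= expR_gt0.
Qed.

(** The jump function is [L2] plus a multiple of the indicator of the half-line left of [c] plus a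
    multiple of the indicator of the point [c]; the last integrates to 0, so [v] drops out. *)
Lemma Rintegral_jump (R : realType) (x y c L1 L2 v : R) : x <= y ->
  let g u := if u < c then L1 else if c < u then L2 else v in
  (@completed_lebesgue_measure R).-integrable (`[x, y] : set (lebesgueR R))
    (EFin \o g) /\
  Rintegral (@completed_lebesgue_measure R) `[x, y] g =
    L2 * (y - x)
    + (L1 - L2) * (if y < c then y - x else if x < c then c - x else 0).
Proof.
move=> xy g; set mu := @completed_lebesgue_measure R.
have mI : measurable (`[x, y] : set (lebesgueR R)).
  exact: measurable_itv_lebesgueR.
have muI : mu `[x, y]%classic = (y - x)%:E.
  rewrite [LHS](_ : _ = @lebesgue_measure R `[x, y]%classic)//.
  rewrite lebesgue_measure_itv/= lte_fin -EFinB; case: ltP => // yx.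
  by rewrite (@le_anti _ _ x y) ?subrr// xy.
have mA : measurable (`]-oo, c[ : set (lebesgueR R)).
  exact: measurable_itv_lebesgueR.
have mC : measurable (`[c, c] : set (lebesgueR R)).
  exact: measurable_itv_lebesgueR.
have intI (h : R -> R) (M : R) :
    measurable_fun [set: lebesgueR R] (h : lebesgueR R -> measurableTypeR R) ->
    (forall u, `|h u| <= M) ->
    mu.-integrable (`[x, y] : set (lebesgueR R)) (EFin \o h).
  move=> mh hM; apply: measurable_bounded_integrable => //.
  - by rewrite [ltLHS]muI ltry.
  - exact: measurable_funTS.
  - exists M; split; first exact: num_real.
    by move=> N MN u _ /=; exact: le_trans (ltW MN).
have i1 (A : set (lebesgueR R)) : measurable A ->
    mu.-integrable (`[x, y] : set (lebesgueR R)) (EFin \o \1_A).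
  move=> mX; apply: (@intI _ 1) => [|u]; first exact: measurable_indic.
  by rewrite indicE; case: (u \in A); rewrite ?normr1 ?normr0.
have iindic (A : set (lebesgueR R)) (r : R) : measurable A ->
    mu.-integrable (`[x, y] : set (lebesgueR R))
      (EFin \o (fun u => r * \1_A u)).
  by move=> mX; exact: integrableZl (i1 A mX).
have Iindic (A : set (lebesgueR R)) (r : R) : measurable A ->
    Rintegral mu (`[x, y] : set (lebesgueR R)) (fun u => r * \1_A u)
    = r * fine (mu (A `&` `[x, y])).
  move=> mX; rewrite RintegralZl//; last exact: i1.
  by rewrite /Rintegral integral_indic.
have icst : mu.-integrable (`[x, y] : set (lebesgueR R)) (EFin \o cst L2).
  exact: (@intI _ `|L2|).
have gE : g = (fun u => cst L2 u + ((L1 - L2) * \1_(`]-oo, c[) u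
    + (v - L2) * \1_(`[c, c]) u)).
  apply/funext => u; rewrite /g !indicE !mem_setE !in_itv/=.
  by case: ltgtP => _ /=; ring.
have i2 := iindic _ (L1 - L2) mA; have i3 := iindic _ (v - L2) mC.
have i23 : mu.-integrable (`[x, y] : set (lebesgueR R)) (EFin \o (fun u =>
    (L1 - L2) * \1_(`]-oo, c[) u + (v - L2) * \1_(`[c, c]) u)).
  exact: (integrableD mI i2 i3).
rewrite gE; split; first exact: (integrableD mI icst i23).
rewrite RintegralD// RintegralD// !Iindic//.
rewrite (Rintegral_cst mu mI L2).
rewrite [X in fine X]muI.
have -> : mu (`[c, c] `&` `[x, y])%classic = 0%E.
  apply/eqP; rewrite eq_le measure_ge0 andbT.
  apply: (@le_trans _ _ (mu `[c, c]%classic)).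
    exact: measureIl.
  rewrite [leLHS](_ : _ = @lebesgue_measure R `[c, c]%classic)//.
  by rewrite lebesgue_measure_itv/= ltxx.
rewrite mulr0 addr0; congr (_ + _ * _).
have [yc|cy] := ltP y c.
  rewrite (_ : _ `&` _ = `[x, y]%classic) ?muI//.
  apply/setIidPr => u /=; rewrite !in_itv/= => /andP[_ uy].
  exact: le_lt_trans yc.
rewrite (_ : _ `&` _ = `[x, c[%classic).
  rewrite [X in fine X](_ : _ = @lebesgue_measure R `[x, c[%classic)//.
  by rewrite lebesgue_measure_itv/= lte_fin; case: ifP.
apply/seteqP; split => u /=; rewrite !in_itv/=; first by case=> -> /andP[->].
by move=> /andP[xu uc]; rewrite uc xu (le_trans (ltW uc)).
Qed.

Lemma mean_jump (R : realType) (w c L1 L2 v : R) (k : int) : 0 < w ->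
  let a := w * c in
  w * Rintegral (@completed_lebesgue_measure R)
    (`[k%:~R / w, (k + 1)%:~R / w] : set R)
    (fun u => if u < c then L1 else if c < u then L2 else v) =
  L1 + (L2 - L1) * ((if a < k%:~R then 1 else 0)
    + (if k == Num.floor a then 1 - (a - (Num.floor a)%:~R) else 0)).
Proof.
move=> w0 a; have wn0 : w != 0 by rewrite gt_eqF.
have xy : k%:~R / w <= (k + 1)%:~R / w :> R.
  by rewrite ler_pM2r ?invr_gt0// ler_int lerDl.
have [_ ->] := Rintegral_jump R _ _ c L1 L2 v xy.
(* Recasting the floor condition as inequalities leaves only comparisons of [a] with [k] and
   [k + 1]. *)
have -> : (if k == Num.floor a then 1 - (a - (Num.floor a)%:~R) else 0) =
    if k%:~R <= a < (k + 1)%:~R then 1 - (a - k%:~R) else 0.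
  by rewrite -floor_eq eq_sym; case: eqP => // ->.
rewrite ltr_pdivrMr// ltr_pdivrMr// [c * w]mulrC -/a.
have -> : c - k%:~R / w = (a - k%:~R) / w by rewrite /a; field.
have -> : (k + 1)%:~R = k%:~R + 1 :> R by rewrite rmorphD.
move: (k%:~R : R) a => K a; rewrite leNgt.
case: (ltP (K + 1) a) => Ka1; case: (ltP K a) => Ka; case: (ltP a K) => aK;
  case: (ltP a (K + 1)) => aK1 /=; try lra; try by field.
  (* What remains are the two endpoints, where the integral and the closed form select different
     branches that agree in value. *)
  by have -> : a = K + 1 by [lra]; field.
by have -> : a = K by [lra]; field.
Qed.

Lemma mean_h_ (R : realType) (f : R -> R) (t w : R) (k : int) :
  [bounded f x | x in `]0, +oo[] -> lebesgue_measurable_fun `]0, +oo[ f ->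
  0 < t -> 0 < w ->
  let a := w * ln t in
  let mean (g : R -> R) := w * Rintegral (@completed_lebesgue_measure R)
    (`[k%:~R / w, (k + 1)%:~R / w] : set R) (fun u => g (expR u)) in
  mean f = mean (h_ f t) + (left_lim f t + (right_lim f t - left_lim f t) *
    ((if a < k%:~R then 1 else 0)
    + (if k == Num.floor a then 1 - (a - (Num.floor a)%:~R) else 0))).
Proof.
move=> fb fm t0 w0 a mean.
(* The value [f t] at the jump matches [h_ f t t = 0], so [f] minus the jump function is [h_ f t] at
   every point, not just almost everywhere. *)
rewrite -(mean_jump _ _ (ln t) _ _ (f t))// /mean.
set g := (X in _ + w * Rintegral _ _ X); set I := `[_, _]%classic.
have hE : (fun u => h_ f t (expR u)) = (fun u => f (expR u) - g u).
  apply/funext => u; rewrite /h_ /g.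
  have -> : (expR u < t) = (u < ln t) by rewrite -[t in LHS]lnK ?ltr_expR.
  have -> : (t < expR u) = (ln t < u) by rewrite -[t in LHS]lnK ?ltr_expR.
  by case: ltgtP => // ->; rewrite lnK// subrr.
have xy : k%:~R / w <= (k + 1)%:~R / w :> R.
  by rewrite ler_pM2r ?invr_gt0// ler_int lerDl.
have [ig _] := Rintegral_jump R _ _ (ln t) (left_lim f t) (right_lim f t) (f t) xy.
have if_ := integrable_bounded_comp_expR R f (k%:~R / w) ((k + 1)%:~R / w) fb fm.
rewrite hE RintegralB//; last exact: measurable_itv_lebesgueR.
by rewrite -mulrDr subrK.
Qed.

(** The factor [w] cancels the cell length [1 / w], so a bound of [f] bounds all means at once. *)
Lemma mean_le (R : realType) (f : R -> R) (w : R) :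
  [bounded f x | x in `]0, +oo[] -> lebesgue_measurable_fun `]0, +oo[ f ->
  0 < w ->
  exists M : R, forall k : int, `|w * Rintegral (@completed_lebesgue_measure R)
    (`[k%:~R / w, (k + 1)%:~R / w] : set R) (fun u => f (expR u))| <= M.
Proof.
move=> fb fm w0; have [M [_ /(_ (M + 1))]] := fb.
rewrite ltrDl ltr01 => /(_ isT) fM; exists (M + 1) => k.
have if_ := integrable_bounded_comp_expR R f (k%:~R / w) ((k + 1)%:~R / w) fb fm.
have mI := measurable_itv_lebesgueR R `[k%:~R / w, (k + 1)%:~R / w].
have xy : k%:~R / w <= (k + 1)%:~R / w :> R.
  by rewrite ler_pM2r ?invr_gt0// ler_int lerDl.
(* A jump function with three equal values is the constant [M + 1]. The shift by 1 is there because
   boundedness is stated for every number above [M]. *)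
have [ic Ic] := Rintegral_jump R _ _ 0 (M + 1) (M + 1) (M + 1) xy.
rewrite normrM gtr0_norm// -ler_pdivlMl//.
apply: le_trans (le_normr_Rintegral mI if_) _.
apply: (@le_trans _ _ (Rintegral (@completed_lebesgue_measure R)
   (`[k%:~R / w, (k + 1)%:~R / w] : set R)
   (fun u : R => if u < 0 then M + 1 else if 0 < u then M + 1 else M + 1))).
  apply: le_Rintegral => //.
    exact: integrable_norm.
  move=> u _; rewrite !if_same; apply: fM.
  by rewrite /= in_itv/= expR_gt0.
rewrite Ic subrr mul0r addr0 rmorphD/=.
by rewrite le_eqVlt; apply/orP; left; apply/eqP; field; rewrite gt_eqF.
Qed.

(** * Splitting the sampling series *)

Lemma kantorovich_split (R : realType) (chi f : R -> R) (t w : R) :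
  is_kernel chi ->
  [bounded f x | x in `]0, +oo[] -> lebesgue_measurable_fun `]0, +oo[ f ->
  0 < t -> 0 < w ->
  let a := w * ln t in
  let fl := (Num.floor a)%:~R : R in
  kantorovich chi w f t = kantorovich chi w (h_ f t) t + left_lim f t +
    (right_lim f t - left_lim f t) *
    (psi_minus chi (t `^ w) + chi (expR (a - fl)) * (1 - (a - fl))).
Proof.
move=> kchi fb fm t0 w0 a fl.
have u0 : 0 < t `^ w by rewrite powR_gt0.
have uE : t `^ w = expR a by rewrite /powR gt_eqF.
have [_ /(_ _ u0)[sc sum1] _] := kchi.
have sabs := kernel_abs_summable R chi _ kchi u0.
set c := fun k : int => chi (expR (- k%:~R) * t `^ w).
pose mean (g : R -> R) (k : int) := w * Rintegral (@completed_lebesgue_measure R)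
  (`[k%:~R / w, (k + 1)%:~R / w] : set R) (fun u => g (expR u)).
set L := left_lim f t; set J := right_lim f t - left_lim f t.
(* [p] sums to [psi_minus] and [d] is the spike at the cell containing [a]. *)
pose p k := if a < k%:~R then c k else 0.
pose k0 := Num.floor a.
pose d (k : int) : R := if k == k0 then c k0 * (1 - (a - fl)) else 0.
have meanE k : mean f k = mean (h_ f t) k + (L + J *
    ((if a < k%:~R then 1 else 0)
    + (if k == k0 then 1 - (a - fl) else 0))).
  exact: mean_h_.
have [sd zd] := zsum_delta R k0 (c k0 * (1 - (a - fl))).
have sp : zsummable p.
  apply: (zsummable_dominated _ 1 _ _ sabs) => k.
  by rewrite mul1r /p; case: ifP => // _; rewrite normr0.
have sf : zsummable (fun k => c k * mean f k).
  have [M fM] := mean_le R f w fb fm w0.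
  apply: (zsummable_dominated _ M _ _ sabs) => k.
  by rewrite normrM mulrC; apply: ler_wpM2r => //; exact: fM.
pose r k := L * c k + J * (p k + d k).
have sr : zsummable r.
  by apply: zsummableD; apply: zsummableZ => //; exact: zsummableD.
(* Writing the series of [h_ f t] as that of [f] minus [r] derives its convergence from these two,
   so no bound on the means of [h_ f t] has to be established. *)
have hE k : c k * mean (h_ f t) k = c k * mean f k + -1 * r k.
  rewrite meanE /r /p /d; case: eqP => [->|_]; case: ifP => _; ring.
have -> : kantorovich chi w (h_ f t) t = kantorovich chi w f t - zsum r.
  rewrite [LHS](_ : _ = zsum (fun k => c k * mean f k + -1 * r k)).
    by rewrite zsumD// ?zsumZ ?mulN1r//; exact: zsummableZ.
  by congr zsum; apply/funext => k; exact: hE.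
have -> : zsum r = L + J * (psi_minus chi (t `^ w) + c k0 * (1 - (a - fl))).
  rewrite zsumD; [|exact: zsummableZ|by apply: zsummableZ; exact: zsummableD].
  rewrite !zsumZ//; last exact: zsummableD.
  rewrite zsumD// zd sum1 mulr1; congr (_ + _ * (_ + _)).
  by rewrite /psi_minus ln_powR; congr zsum; apply/funext => k; rewrite /p /c mulrC.
have -> : c k0 = chi (expR (a - fl)) by rewrite /c uE -expRD addrC.
ring.
Qed.

Theorem lemma1 (R : realType) (chi : R -> R) (f : R -> R) (t w : R)
    (hchi : is_kernel chi)
    (fbounded : [bounded f x | x in `]0, +oo[])
    (fmeas : lebesgue_measurable_fun `]0, +oo[ f)
    (ht : 0 < t)
    (fright : cvg (f (t + y) @[y --> 0^'+]))
    (fleft : cvg (f (t - y) @[y --> 0^'+]))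
    (hw : 0 < w) :
  let a := w * ln t in
  let fl := (Num.floor a)%:~R : R in
  (a \isn't a Num.int ->
    kantorovich chi w f t =
      kantorovich chi w (h_ f t) t + left_lim f t
      + (chi (expR (a - fl)) + psi_minus chi (t `^ w))
          * (right_lim f t - left_lim f t)
      - chi (expR (a - fl)) * (a - fl) * (right_lim f t - left_lim f t)) /\
  (a \is a Num.int ->
    kantorovich chi w f t =
      kantorovich chi w (h_ f t) t + left_lim f t
      + (chi 1 + psi_minus chi (t `^ w))
          * (right_lim f t - left_lim f t)).
Proof.
move=> a fl; rewrite (kantorovich_split R chi f t w)// -/a -/fl.
split=> [_|aint]; first by ring.
(* For integer [a] the fractional part vanishes: the weight [1 - (a - fl)] becomes 1 and the kernel
   is evaluated at [expR 0 = 1]. *)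
have -> : a - fl = 0 by rewrite /fl floorK// subrr.
by rewrite expR0; ring.
Qed.
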